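(* Let $\mathscr{H}$ be a complex Hilbert space with $\dim\mathscr{H}=2$ and let $k\ge 0$ be a real number. Then $$\mathfrak{D}_k(\mathscr{H})=\left\{\alpha S:\ \alpha\in\mathbb{C}\setminus\{0\},\ S\in\mathscr{S}_0(\mathscr{H}),\ \left|\frac{\lambda}{\mu}+\frac{\mu}{\lambda}+k\right|\ge k+2\ \text{ for all }\lambda,\mu\in\sigma(S)\right\}.$$
   Context: $\mathbb{B}(\mathscr{H})$ is the algebra of bounded linear operators on $\mathscr{H}$ with operator norm $\|\cdot\|$; $\mathscr{S}_0(\mathscr{H})$ is the set of invertible self-adjoint operators in $\mathbb{B}(\mathscr{H})$; $\sigma(S)$ is the spectrum of $S$. For a real number $k$, $\mathfrak{D}_k(\mathscr{H})$ denotes the set of all invertible $S\in\mathbb{B}(\mathscr{H})$ such that $\|SXS^{-1}+S^{-1}XS+kX\|\ge(k+2)\|X\|$ for all $X\in\mathbb{B}(\mathscr{H})$. *)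

(* Defs.v *)
From HB Require Import structures.
From mathcomp Require Import all_boot all_order all_algebra.
From mathcomp Require Import complex.
From mathcomp Require Import boolp classical_sets reals.

Set Implicit Arguments.
Unset Strict Implicit.
Unset Printing Implicit Defensive.

Import Order.TTheory GRing.Theory Num.Theory.

Local Open Scope ring_scope.
Local Open Scope classical_set_scope.

(* A finite-dimensional complex Hilbert space is a vectType over R[i] with a
   positive definite hermitian form (linear in the first argument).  It is
   automatically complete, and all its linear endomorphisms are bounded, so
   that B(H) is 'End(H). *)
Section FiniteDimHilbert.
Variables (R : realType) (H : vectType R[i]) (dot : {dot H for Num.conj}).
Implicit Types (u v : H) (S X : 'End(H)).

(* dot v v is a nonnegative real, so taking its real part loses nothing *)
Definition hnorm v : R := Num.sqrt (complex.Re (dot v v)).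

Definition opnorm X : R := sup [set hnorm (X v) | v in [set v | hnorm v <= 1]].

Definition invertible S : Prop :=
  exists T : 'End(H), (T \o S = \1)%VF /\ (S \o T = \1)%VF.

Definition spectrum S : set R[i] := [set z | ~ invertible (S - z *: \1%VF)].

Definition selfadjoint S : Prop := forall u v, dot (S u) v = dot u (S v).

Definition invertible_selfadjoint : set 'End(H) :=
  [set S | invertible S /\ selfadjoint S].

(* S^-1 in lfun_scope is a total pseudo-inverse; it is the two-sided inverse
   when S is invertible. *)
Definition frakD (k : R) : set 'End(H) :=
  [set S | invertible S /\
    forall X : 'End(H),
      (k + 2) * opnorm X <=
        opnorm ((S \o X \o S^-1)%VF + (S^-1 \o X \o S)%VF + k%:C%C *: X)].

End FiniteDimHilbert.

(* Main.v *)
Require Import Defs.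
From HB Require Import structures.
From mathcomp Require Import all_boot all_order all_algebra.
From mathcomp Require Import complex.
From mathcomp Require Import boolp classical_sets reals.
From mathcomp Require Import ring lra.

(* In an orthonormal basis making S upper triangular, S = [[l, b], [0, m]],
   write Phi X = S X S^-1 + S^-1 X S + k X, K = k + 2 and
   c = l / m + m / l + k.  If b = 0, Phi multiplies the diagonal entries of X
   by K and the off-diagonal ones by c.  For real c with |c| >= K its inverse,
   up to the factor K, is a Schur multiplier by a positive semidefinite matrix
   with unit diagonal, hence a contraction; this gives one inclusion.
   Conversely, testing the inequality on suitable matrices X shows in turn that
   |c| >= K (X = E12), that b = 0, and that c is real (by comparing rotations
   with their preimages).  Since k >= 0, a real c with |c| >= K forces m / l to
   be real, so S / l is self-adjoint. *)

Set Implicit Arguments.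
Unset Strict Implicit.
Unset Printing Implicit Defensive.

Import Order.TTheory GRing.Theory Num.Theory.

Local Open Scope ring_scope.
Local Open Scope classical_set_scope.

(** * Squared modulus of complex numbers *)

Section SquaredModulus.
Variable R : realType.
Implicit Types (a : R) (z w : R[i]).

(** Valued in [R] rather than [R[i]], so that all estimates take place in a totally ordered
    field. *)
Definition sqmod z : R := complex.Re z ^+ 2 + complex.Im z ^+ 2.

Lemma sqmodE z : (sqmod z)%:C%C = `|z| ^+ 2.
Proof. exact: add_Re2_Im2. Qed.

Lemma sqmod_ge0 z : 0 <= sqmod z.
Proof. by rewrite addr_ge0 ?sqr_ge0. Qed.

Lemma sqmodM z w : sqmod (z * w) = sqmod z * sqmod w.
Proof. by apply: complexI; rewrite rmorphM /= !sqmodE normrM exprMn. Qed.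

Lemma sqmodN z : sqmod (- z) = sqmod z.
Proof. by apply: complexI; rewrite !sqmodE normrN. Qed.

Lemma sqmod_real a : sqmod a%:C%C = a ^+ 2.
Proof. by rewrite /sqmod /= expr0n addr0. Qed.

Lemma sqmod0 : sqmod 0 = 0.
Proof. by rewrite sqmod_real expr0n. Qed.

Lemma sqmod1 : sqmod 1 = 1.
Proof. by rewrite sqmod_real expr1n. Qed.

Lemma sqmod_gt0 z : (0 < sqmod z) = (z != 0).
Proof.
by rewrite -ltcR sqmodE lt_def sqrf_eq0 normr_eq0 exprn_ge0 // andbT.
Qed.

Lemma sqmod_eq0 z : (sqmod z == 0) = (z == 0).
Proof. by rewrite -[RHS]negbK -sqmod_gt0 lt_def sqmod_ge0 andbT negbK. Qed.

Lemma le_norm_sqmod a z : 0 <= a -> (a%:C%C <= `|z|) = (a ^+ 2 <= sqmod z).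
Proof.
move=> a0; have aC0 : 0 <= a%:C%C by rewrite ler0c.
by rewrite -lecR rmorphXn /= sqmodE ler_sqr ?nnegrE.
Qed.

(** Polar form of the square: [v] is the square of the phase of [z]. *)
Lemma sqr_ratio z : z != 0 ->
  exists2 v, sqmod v = 1 & z ^+ 2 = v * (sqmod z)%:C%C.
Proof.
move=> z0; exists (z ^+ 2 / (sqmod z)%:C%C).
  have s0 : sqmod z != 0 by rewrite sqmod_eq0.
  rewrite sqmodM expr2 sqmodM -fmorphV sqmod_real.
  by field.
by rewrite divfK // (inj_eq (@complexI R)) sqmod_eq0.
Qed.

(** Write z = x + iy and n = |z|^2. The imaginary part of z + 1/z is y (1 - 1/n), so y = 0 or n = 1.
    In the second case z + 1/z = 2x, and if y were nonzero then |x| < 1, so that k >= 0 would give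
    |2x + k| < k + 2. *)
Lemma real_of_ratio_sum (k : R) z :
  0 <= k -> z != 0 -> complex.Im (z + z^-1 + k%:C%C) = 0 ->
  (k + 2) ^+ 2 <= sqmod (z + z^-1 + k%:C%C) -> complex.Im z = 0.
Proof.
case: z => x y k0; rewrite -sqmod_eq0 /sqmod /=.
set n := (x ^+ 2 + y ^+ 2) => n0; rewrite addr0 => im0.
have ynE : y * n = y.
  have := congr1 ( *%R^~ n) im0; rewrite mul0r mulrDl mulNr divfK //.
  by move/eqP; rewrite subr_eq0 => /eqP.
rewrite im0 expr0n addr0 => hk; apply/eqP; apply: contraT => y0.
have n1 : n = 1 by apply: (mulfI y0); rewrite mulr1.
move: hk; rewrite n1 invr1 mulr1; move: n1; rewrite /n => n1 hk.
have y2 : 0 < y ^+ 2 by rewrite exprn_even_gt0.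
nra.
Qed.

End SquaredModulus.

(** * The norm of the Hilbert space *)

Section HilbertNorm.
Variables (R : realType) (H : vectType R[i]) (dot : {dot H for Num.conj}).
Implicit Types (a : R) (z : R[i]) (u v : H).

Lemma sqr_hnormC v : (hnorm dot v ^+ 2)%:C%C = dot v v.
Proof.
have := dnorm_ge0 dot v; rewrite lecE => /andP[/eqP im0 re0].
by rewrite sqr_sqrtr // [RHS]complexE im0 mulr0 addr0.
Qed.

Lemma hnormC v : (hnorm dot v)%:C%C = sqrtC (dot v v).
Proof. by rewrite -sqr_hnormC rmorphXn sqrCK // ler0c sqrtr_ge0. Qed.

Lemma hnorm_ge0 v : 0 <= hnorm dot v.
Proof. exact: sqrtr_ge0. Qed.

Lemma hnorm_eq0 v : (hnorm dot v == 0) = (v == 0).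
Proof. by rewrite -(inj_eq (@complexI R)) hnormC sqrt_dnorm_eq0. Qed.

Lemma hnorm0 : hnorm dot 0 = 0.
Proof. by apply/eqP; rewrite hnorm_eq0. Qed.

Lemma sqr_hnormZ z v : hnorm dot (z *: v) ^+ 2 = sqmod z * hnorm dot v ^+ 2.
Proof.
by apply: complexI; rewrite [RHS]rmorphM /= !sqr_hnormC dnormZ sqmodE.
Qed.

Lemma hnormZ z v : hnorm dot (z *: v) = Num.sqrt (sqmod z) * hnorm dot v.
Proof.
apply/eqP; rewrite -(@eqrXn2 _ 2) ?mulr_ge0 ?hnorm_ge0 ?sqrtr_ge0 //.
by rewrite sqr_hnormZ exprMn (sqr_sqrtr (sqmod_ge0 z)).
Qed.

Lemma hnormZ_ge0 a v : 0 <= a -> hnorm dot (a%:C%C *: v) = a * hnorm dot v.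
Proof. by move=> a0; rewrite hnormZ sqmod_real sqrtr_sqr ger0_norm. Qed.

Lemma ler_hnormD u v : hnorm dot (u + v) <= hnorm dot u + hnorm dot v.
Proof. by rewrite -lecR rmorphD /= !hnormC triangle_lerif. Qed.

Lemma dot_conj u v : dot u v = (dot v u)^*.
Proof. by rewrite hermC /= expr0 mul1r. Qed.

End HilbertNorm.

(** * Inverses and eigenvalues *)

Section Inverse.
Variables (R : realType) (H : vectType R[i]).
Implicit Types (S T : 'End(H)).

(** A left inverse makes [S] injective, and the pseudo-inverse of an injective endomorphism is a
    right inverse, here by finite dimension. *)
Lemma inv_lfun_eq S T : (T \o S = \1)%VF -> (S^-1)%VF = T.
Proof.
move=> TS; have S0 : lker S == 0%VS.
  apply/lker0P => u v Suv.
  have E w : w = T (S w) by rewrite -comp_lfunE TS id_lfunE.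
  by rewrite (E u) Suv -E.
by rewrite -[LHS]comp_lfun1l -TS -comp_lfunA lker0_compfV // comp_lfun1r.
Qed.

Lemma invertible_eq0 S v : invertible S -> S v = 0 -> v = 0.
Proof.
by case=> T [TS _] Sv; rewrite -[v]id_lfunE -TS comp_lfunE Sv linear0.
Qed.

Lemma spectrum_eigenvalue S v z : v != 0 -> S v = z *: v -> spectrum S z.
Proof.
move=> v0 Sv Sz; case/eqP: v0; apply: (invertible_eq0 Sz).
by rewrite add_lfunE opp_lfunE scale_lfunE id_lfunE Sv subrr.
Qed.

End Inverse.

(** * Gram-Schmidt in dimension two *)

Section OrthonormalBasis.
Variables (R : realType) (H : vectType R[i]) (dot : {dot H for Num.conj}).
Hypothesis hdim : \dim {:H} = 2%N.
Implicit Types (e f u v : H).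

Definition orthonormal_pair e f :=
  [/\ dot e e = 1, dot f f = 1 & dot e f = 0].

(** The first vector is [u] normalized, so that an eigenvector [u] yields an eigenvector [e]. *)
Lemma exists_orthonormal_pair u : u != 0 ->
  exists e f, orthonormal_pair e f /\ exists2 z, z != 0 & u = z *: e.
Proof.
have normalize v :
    v != 0 -> exists2 z, z != 0 & dot (z^-1 *: v) (z^-1 *: v) = 1.
  move=> v0; have h0 : hnorm dot v != 0 by rewrite hnorm_eq0.
  exists (hnorm dot v)%:C%C; first by rewrite (inj_eq (@complexI R)).
  rewrite -sqr_hnormC -fmorphV hnormZ_ge0 ?invr_ge0 ?hnorm_ge0 //.
  by rewrite mulVf // expr1n.
move=> u0; have [z z0 ee] := normalize u u0.
set e := z^-1 *: u in ee.
have uE : u = z *: e by rewrite scalerA divff // scale1r.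
(* Otherwise the line through [e] would be the whole space, of dimension 2. *)
have [v /negP ve] : exists v, ~ v \in <[e]>%VS.
  apply/existsNP => all_e; have: ({:H} <= <[e]>)%VS.
    by apply/subvP => v _; apply: all_e.
  by move/dimvS; rewrite hdim dim_vline; case: (e != 0).
pose w := v - dot v e *: e.
have w0 : w != 0.
  apply: contraNneq ve => /eqP; rewrite subr_eq0 => /eqP ->.
  by rewrite memvZ ?memv_line.
have [y y0 ff] := normalize w w0.
exists e, (y^-1 *: w); split; last by exists z.
split=> //; rewrite dot_conj linearZl_LR linearBl linearZl_LR /= ee mulr1 subrr.
by rewrite mulr0 conjC0.
Qed.

End OrthonormalBasis.

(** * Matrices and operator norm in an orthonormal basis *)

Section Coordinates.
Variables (R : realType) (H : vectType R[i]) (dot : {dot H for Num.conj}).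
Variables (e f : H).
Implicit Types (v : H) (X Y : 'End(H)).

Definition lincomb (x y : R[i]) : H := x *: e + y *: f.

(** The operator with matrix [[a, b], [c, d]], whose columns are the images of [e] and [f].
    Coordinates are [dot v e] and [dot v f] because the form is linear in its first argument. *)
Definition matfun (a b c d : R[i]) v : H :=
  lincomb (a * dot v e + b * dot v f) (c * dot v e + d * dot v f).

Fact matfun_is_linear a b c d : linear (matfun a b c d).
Proof.
move=> z u v; rewrite /matfun /lincomb !linearDl !linearZl_LR /= scalerDr.
rewrite !scalerA.
by rewrite addrACA -!scalerDl; congr (_ *: _ + _ *: _); ring.
Qed.

HB.instance Definition _ a b c d :=
  GRing.isLinear.Build R[i] H H *:%R (matfun a b c d)
    (matfun_is_linear a b c d).

Definition matop a b c d : 'End(H) := linfun (matfun a b c d).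

Lemma lincombD x y z t : lincomb x y + lincomb z t = lincomb (x + z) (y + t).
Proof. by rewrite /lincomb !scalerDl addrACA. Qed.

Lemma lincombZ z x y : z *: lincomb x y = lincomb (z * x) (z * y).
Proof. by rewrite /lincomb scalerDr !scalerA. Qed.

Hypothesis hdim : \dim {:H} = 2%N.
Hypothesis hef : orthonormal_pair dot e f.

Lemma dot_lincombl x y : dot (lincomb x y) e = x.
Proof.
case: hef => ee ff ef; rewrite linearDl !linearZl_LR /= ee.
by rewrite (dot_conj dot f) ef conjC0 mulr1 mulr0 addr0.
Qed.

Lemma dot_lincombr x y : dot (lincomb x y) f = y.
Proof.
by case: hef => ee ff ef; rewrite linearDl !linearZl_LR /= ff ef mulr1 mulr0
  add0r.
Qed.

Lemma matopE a b c d x y :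
  matop a b c d (lincomb x y) = lincomb (a * x + b * y) (c * x + d * y).
Proof. by rewrite lfunE /= /matfun dot_lincombl dot_lincombr. Qed.

Lemma lincomb_coord v : v = lincomb (dot v e) (dot v f).
Proof.
have [ee ff ef] := hef.
have frE : free [:: e; f] by apply/(@orthonormal_free _ _ dot)/orthonormal2P.
have : basis_of {:H} [:: e; f] by rewrite basisEfree frE subvf hdim.
move/span_basis; rewrite span_cons span_seq1 => efE.
have /memv_addP[_ /vlineP[x ->] [_ /vlineP[y ->] ->]] : v \in
  (<[e]> + <[f]>)%VS.
  by rewrite efE memvf.
by rewrite -/(lincomb x y) dot_lincombl dot_lincombr.
Qed.

Lemma lincomb_eqfun X Y :
  (forall x y, X (lincomb x y) = Y (lincomb x y)) -> X = Y.
Proof. by move=> XY; apply/lfunP => v; rewrite (lincomb_coord v). Qed.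

Lemma matop_coord X :
  X = matop (dot (X e) e) (dot (X f) e) (dot (X e) f) (dot (X f) f).
Proof.
apply: lincomb_eqfun => x y; rewrite matopE [LHS]linearD !linearZ /=.
rewrite {1}(lincomb_coord (X e)) {1}(lincomb_coord (X f)) !lincombZ lincombD.
by congr lincomb; ring.
Qed.

Lemma matop_comp a b c d a' b' c' d' :
  (matop a b c d \o matop a' b' c' d')%VF =
  matop (a * a' + b * c') (a * b' + b * d') (c * a' + d * c') (c * b' + d * d').
Proof.
by apply: lincomb_eqfun => x y; rewrite comp_lfunE !matopE; congr lincomb; ring.
Qed.

Lemma matopD a b c d a' b' c' d' :
  matop a b c d + matop a' b' c' d' = matop (a + a') (b + b') (c + c') (d + d').
Proof.
apply: lincomb_eqfun => x y; rewrite add_lfunE !matopE lincombD.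
by congr lincomb; ring.
Qed.

Lemma matopZ z a b c d :
  z *: matop a b c d = matop (z * a) (z * b) (z * c) (z * d).
Proof.
apply: lincomb_eqfun => x y; rewrite scale_lfunE !matopE lincombZ.
by congr lincomb; ring.
Qed.

Lemma matop1 : matop 1 0 0 1 = \1%VF.
Proof.
by apply: lincomb_eqfun => x y; rewrite id_lfunE matopE; congr lincomb; ring.
Qed.

Lemma sqr_hnorm_lincomb x y :
  hnorm dot (lincomb x y) ^+ 2 = sqmod x + sqmod y.
Proof.
apply: complexI; rewrite sqr_hnormC rmorphD /= !sqmodE !normCK.
rewrite {2}/lincomb linearDr !linearZr_LR /=.
by rewrite dot_lincombl dot_lincombr mulrC [_^* * y]mulrC.
Qed.

(** Both coordinates of a vector of the unit ball have modulus at most 1. Boundedness is what makes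
    the [sup] in [opnorm] a genuine supremum. *)
Lemma has_ubound_hnorm_image X :
  has_ubound [set hnorm dot (X v) | v in [set v | hnorm dot v <= 1]].
Proof.
exists (hnorm dot (X e) + hnorm dot (X f)) => _ [v /= v1 <-].
rewrite (lincomb_coord v) in v1 *; move: (dot v e) (dot v f) v1 => x y v1.
have xy1 : sqmod x + sqmod y <= 1.
  by rewrite -sqr_hnorm_lincomb expr_le1 ?hnorm_ge0.
rewrite linearD !linearZ /= (le_trans (ler_hnormD _ _ _)) //.
have sqrt1 z : sqmod z <= 1 -> Num.sqrt (sqmod z) <= 1.
  by move=> z1; rewrite -[leRHS]sqrtr1 ler_sqrt.
rewrite !hnormZ lerD // ler_piMl ?hnorm_ge0 // sqrt1 //.
  by apply: le_trans xy1; rewrite lerDl sqmod_ge0.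
by apply: le_trans xy1; rewrite lerDr sqmod_ge0.
Qed.

Lemma ler_opnorm1 X v : hnorm dot v <= 1 -> hnorm dot (X v) <= opnorm dot X.
Proof.
by move=> v1; apply: ub_le_sup; [exact: has_ubound_hnorm_image|exists v].
Qed.

Lemma opnorm_le X (M : R) :
  (forall v, hnorm dot v <= 1 -> hnorm dot (X v) <= M) -> opnorm dot X <= M.
Proof.
move=> XM; apply: ge_sup; last by move=> _ [v v1 <-]; apply: XM.
(* The set of norms is nonempty, with witness the zero vector. *)
by exists (hnorm dot (X 0)), 0 => //=; rewrite hnorm0.
Qed.

Lemma ler_opnorm X v : hnorm dot (X v) <= opnorm dot X * hnorm dot v.
Proof.
have [->|v0] := eqVneq v 0; first by rewrite linear0 !hnorm0 mulr0.
have h0 : 0 < hnorm dot v by rewrite lt_def hnorm_eq0 v0 hnorm_ge0.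
have := @ler_opnorm1 X ((hnorm dot v)^-1%:C%C *: v).
rewrite linearZ /= !hnormZ_ge0 ?invr_ge0 ?hnorm_ge0 // mulVf ?gt_eqF //.
by rewrite mulrC -ler_pdivlMr ?invr_gt0 // invrK; apply.
Qed.

(** Through K ||X|| <= ||Y|| <= sqrt M, a comparison of operator norms becomes a pointwise
    inequality between squared norms, which coordinates can compute. *)
Lemma sqr_bound_of_opnorm_le (K M : R) X Y : 0 <= K -> 0 <= M ->
  K * opnorm dot X <= opnorm dot Y ->
  (forall v, hnorm dot (Y v) ^+ 2 <= M * hnorm dot v ^+ 2) ->
  forall v, K ^+ 2 * hnorm dot (X v) ^+ 2 <= M * hnorm dot v ^+ 2.
Proof.
move=> K0 M0 XY YM v; have Ysqrt : opnorm dot Y <= Num.sqrt M.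
  apply: opnorm_le => u u1; rewrite -ler_sqr ?nnegrE ?hnorm_ge0 ?sqrtr_ge0 //.
  rewrite (sqr_sqrtr M0) (le_trans (YM u)) // ler_piMr //.
  by rewrite expr_le1 ?hnorm_ge0.
have : K * hnorm dot (X v) <= Num.sqrt M * hnorm dot v.
  apply: le_trans (ler_wpM2r (hnorm_ge0 dot v) (le_trans XY Ysqrt)).
  by rewrite -mulrA ler_wpM2l // ler_opnorm.
rewrite -ler_sqr ?nnegrE ?mulr_ge0 ?hnorm_ge0 ?sqrtr_ge0 // !exprMn.
by rewrite (sqr_sqrtr M0).
Qed.

End Coordinates.

(** * Triangular form, and what the norm inequality forces on it *)

Section TriangularForm.
Variables (R : realType) (H : vectType R[i]) (dot : {dot H for Num.conj}).
Hypothesis hdim : \dim {:H} = 2%N.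
Implicit Types (S X : 'End(H)).

Lemma exists_eigenvector S : exists u, u != 0 /\ exists z, S u = z *: u.
Proof.
have /exists_orthonormal_pair -/(_ dot hdim)[e [f [hef _]]] : vpick {:H} != 0.
  by rewrite vpick0 -dimv_eq0 hdim.
rewrite (matop_coord hdim hef S).
move: (dot (S e) e) (dot (S f) e) (dot (S e) f) (dot (S f) f) => a b c d.
have lincomb0 x y : lincomb e f x y = 0 -> x = 0 /\ y = 0.
  move=> xy0; have [xE yE] := (dot_lincombl hef x y, dot_lincombr hef x y).
  by rewrite xy0 in xE yE; rewrite -xE -yE !linear0l.
have [->|c0] := eqVneq c 0.
  exists (lincomb e f 1 0); split.
    by apply/eqP => /lincomb0[/eqP]; rewrite oner_eq0.
  by exists a; rewrite (matopE hef) lincombZ; congr lincomb; ring.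
(* Quadratic formula for the characteristic polynomial; the eigenvector will be (z - d, c). *)
pose s := sqrtC ((a - d) ^+ 2 + 4 * b * c); pose z := (a + d + s) / 2.
have zE : (z - a) * (z - d) = b * c.
  have -> : (z - a) * (z - d) = (s ^+ 2 - (a - d) ^+ 2) / 4.
    by rewrite /z; field.
  by rewrite sqrtCK; field.
exists (lincomb e f (z - d) c); split.
  by apply/eqP => /lincomb0[_ /eqP]; rewrite (negPf c0).
exists z; rewrite (matopE hef) lincombZ; congr lincomb; last by ring.
by rewrite -zE; ring.
Qed.

(** Schur triangularization: take [e] to be a unit eigenvector and complete it. *)
Lemma exists_orthonormal_pair_triangular S :
  exists e f, orthonormal_pair dot e f /\
  exists l b m, S = matop dot e f l b 0 m /\ S e = l *: e.
Proof.
have [u [u0 [l Su]]] := exists_eigenvector S.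
have [e [f [hef [z z0 uE]]]] := exists_orthonormal_pair dot hdim u0.
have Se : S e = l *: e.
  by apply: (scalerI z0); rewrite -[LHS]linearZ /= -uE Su {1}uE !scalerA mulrC.
exists e, f; split=> //; exists l, (dot (S f) e), (dot (S f) f); split=> //.
case: (hef) => ee ff ef.
by rewrite {1}(matop_coord hdim hef S) Se !linearZl_LR /= ee ef mulr1 mulr0.
Qed.

Variables (e f : H).
Hypothesis hef : orthonormal_pair dot e f.

Local Notation mat := (matop dot e f).

Lemma triangular_inv l b m : l != 0 -> m != 0 ->
  ((mat l b 0 m)^-1)%VF = mat l^-1 (- (b / (l * m))) 0 m^-1.
Proof.
move=> l0 m0; apply: inv_lfun_eq.
rewrite (matop_comp hdim hef) -(matop1 hdim hef).
by congr matop; field; rewrite ?l0 ?m0.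
Qed.

Lemma lincomb0r y : lincomb e f 0 y = y *: f.
Proof. by rewrite /lincomb scale0r add0r. Qed.

(** The map Phi, spelled exactly as the expression in [frakD]. *)
Definition sandwich (k : R) S X : 'End(H) :=
  (S \o X \o S^-1)%VF + (S^-1 \o X \o S)%VF + k%:C%C *: X.

Variables (k : R) (l b m : R[i]).
Hypotheses (k0 : 0 <= k) (l0 : l != 0) (m0 : m != 0).
Let S := mat l b 0 m.
Let c := l / m + m / l + k%:C%C.
Let K : R[i] := (k + 2)%:C%C.
Hypothesis hS : forall X, (k + 2) * opnorm dot X <= opnorm dot (sandwich k S X).

Fact scalarE : K = k%:C%C + 2.
Proof. by rewrite /K rmorphD /= rmorphMn. Qed.

(** Common pattern of the tests below: choose a matrix X whose image Y has an easily bounded norm,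
    then evaluate X at one vector (x, y). *)
Lemma sandwich_test (M : R) x11 x12 x21 x22 y11 y12 y21 y22 :
  let Y := mat y11 y12 y21 y22 in
  sandwich k S (mat x11 x12 x21 x22) = Y -> 0 <= M ->
  (forall v, hnorm dot (Y v) ^+ 2 <= M * hnorm dot v ^+ 2) ->
  forall x y, (k + 2) ^+ 2 *
    (sqmod (x11 * x + x12 * y) + sqmod (x21 * x + x22 * y))
                <= M * (sqmod x + sqmod y).
Proof.
move=> Y XY M0 YM x y; have k2 : 0 <= k + 2 by rewrite addr_ge0.
have := sqr_bound_of_opnorm_le hdim hef k2 M0 (hS (mat x11 x12 x21 x22)).
rewrite XY => /(_ YM (lincomb e f x y)).
by rewrite (matopE hef) !(sqr_hnorm_lincomb hef).
Qed.

(** Whatever [b] is, the matrix unit E12 is an eigenvector of Phi with eigenvalue [c]. *)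
Lemma sandwich_ratio_large : (k + 2) ^+ 2 <= sqmod c.
Proof.
have XY : sandwich k S (mat 0 1 0 0) = mat 0 c 0 0.
  rewrite /sandwich /S (triangular_inv b l0 m0) !(matop_comp hdim hef).
  rewrite (matopZ hdim hef) !(matopD hdim hef).
  by congr matop; rewrite /c; field; rewrite ?l0 ?m0.
have := sandwich_test XY (sqmod_ge0 c) _ 0 1.
rewrite !(mul0r, mulr0, mulr1, addr0, add0r, sqmod0, sqmod1); apply => v.
rewrite (lincomb_coord hdim hef v) (matopE hef) !(sqr_hnorm_lincomb hef).
by rewrite !(mul0r, addr0, add0r, sqmod0) sqmodM ler_wpM2l ?sqmod_ge0 // lerDr
  sqmod_ge0.
Qed.

(* X and its image are chosen so that the image is a multiple of diag(1,-1),
   while X has an off-diagonal entry as soon as b != 0. *)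
Lemma sandwich_offdiag_neq : l != m -> b = 0.
Proof.
move=> lm; have c0 : c != 0.
  rewrite -sqmod_gt0; apply: lt_le_trans sandwich_ratio_large.
  by rewrite exprn_gt0 // ltr_wpDl.
(* Phi sends diag(1, -1) to a matrix with upper right entry 2 (b / l) (1 - l / m), and adding q E12
   contributes q c; this [q] cancels the two. *)
pose q := - (2 * (b / l) * (1 - l / m)) / c.
have XY : sandwich k S (mat 1 q 0 (-1)) = mat K 0 0 (- K).
  rewrite /sandwich /S (triangular_inv b l0 m0) !(matop_comp hdim hef).
  rewrite (matopZ hdim hef) !(matopD hdim hef).
  have qc : q * (l / m + m / l + k%:C%C) = - (2 * (b / l) * (1 - l / m)).
    by rewrite divfK.
  congr matop; rewrite ?scalarE;
    [by field; rewrite ?l0 ?m0| |by ring|by field; rewrite ?l0 ?m0].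
  apply/eqP; rewrite -subr_eq0; apply/eqP.
  transitivity (q * (l / m + m / l + k%:C%C) + (2 * (b / l) * (1 - l / m))).
    by field; rewrite ?l0 ?m0.
  by rewrite qc addNr.
have K2 : 0 < (k + 2) ^+ 2 by rewrite exprn_gt0 // ltr_wpDl.
(* At [f] the test reads |q|^2 + 1 <= 1. *)
have := sandwich_test XY (ltW K2) _ 0 1.
rewrite !(mul0r, mulr0, mulr1, addr0, add0r, sqmod0, sqmodN, sqmod1) => H1.
have q0 : q = 0.
  apply/eqP; rewrite -sqmod_eq0 eq_le sqmod_ge0 andbT.
  suff : (k + 2) ^+ 2 * (sqmod q + 1) <= (k + 2) ^+ 2.
    by rewrite ger_pMr // gerDr.
  apply: H1 => v.
  rewrite (lincomb_coord hdim hef v) (matopE hef) !(sqr_hnorm_lincomb hef).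
  by rewrite !(mul0r, addr0, add0r, mulNr, sqmodN) !sqmodM sqmod_real -mulrDr.
have lm1 : 1 - l / m != 0.
  by rewrite subr_eq0 eq_sym; apply: contra lm => /eqP/divr1_eq ->.
apply/eqP; move/eqP: q0; rewrite !mulf_eq0 oppr_eq0 !mulf_eq0 !invr_eq0.
by rewrite pnatr_eq0 (negPf c0) (negPf l0) (negPf lm1) !orbF.
Qed.

(* With X = [[0, u], [1, 0]], the image is (k + 2) *: [[0, v], [1, 0]] with v
   unimodular, while |u| > 1 as soon as b != 0. *)
Lemma sandwich_offdiag_eq : l = m -> b = 0.
Proof.
move=> lm; apply/eqP; apply: contraT => b0.
have bl0 : b / l != 0 by rewrite mulf_neq0 ?invr_eq0.
have [v v1 bE] := sqr_ratio bl0; set s := sqmod (b / l) in bE.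
have s0 : 0 < s by rewrite sqmod_gt0.
have k2 : 0 < k + 2 by rewrite ltr_wpDl.
have K0 : K != 0 by rewrite /K (inj_eq (@complexI R)) gt_eqF.
(* The upper right entry of the image is u K - 2 (b / l)^2. Giving [u] the phase [v] of (b / l)^2
   and this modulus [r] > 1 reduces that entry to v K. *)
pose r := 1 + 2 * s / (k + 2); pose u := v * r%:C%C.
have uK : u * K = v * K + 2 * (b / l) ^+ 2.
  rewrite /u -mulrA -rmorphM bE mulrCA -mulrDr; congr (v * _).
  have -> : r * (k + 2) = (k + 2) + 2 * s by rewrite /r; field; rewrite gt_eqF.
  by rewrite rmorphD rmorphM /= rmorphMn.
have XY : sandwich k S (mat 0 u 1 0) = mat 0 (v * K) K 0.
  rewrite /sandwich /S (triangular_inv b l0 m0) !(matop_comp hdim hef).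
  rewrite (matopZ hdim hef) !(matopD hdim hef) -lm.
  have -> : v * K = u * K - 2 * (b / l) ^+ 2 by rewrite uK addrK.
  by congr matop; rewrite ?scalarE; field; rewrite ?l0.
have K2 : 0 < (k + 2) ^+ 2 by rewrite exprn_gt0.
have := sandwich_test XY (ltW K2) _ 0 1.
rewrite !(mul0r, mulr0, mulr1, addr0, add0r, sqmod0, sqmodN, sqmod1) => H1.
have : sqmod u <= 1.
  suff : (k + 2) ^+ 2 * sqmod u <= (k + 2) ^+ 2 by rewrite ger_pMr.
  apply: H1 => w.
  rewrite (lincomb_coord hdim hef w) (matopE hef) !(sqr_hnorm_lincomb hef).
  by rewrite !(mul0r, addr0, add0r) !sqmodM v1 mul1r sqmod_real -mulrDr
    [sqmod (dot w f) + _]addrC.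
rewrite sqmodM v1 mul1r sqmod_real leNgt; case/negP.
have r1 : 1 < r by rewrite ltrDl divr_gt0 // mulr_gt0.
by rewrite exprn_egt1.
Qed.

Lemma sandwich_offdiag : b = 0.
Proof.
have [|] := eqVneq l m;
  [exact: sandwich_offdiag_eq|exact: sandwich_offdiag_neq].
Qed.

(* X = [[c, K x], [- K x, c]] is normal with eigenvector (1, i), and its image
   K c [[1, x], [- x, 1]] is a multiple of a rotation. *)
Lemma sandwich_ratio_real : complex.Im c = 0.
Proof.
have b0 := sandwich_offdiag; set t := complex.Im c.
have K2 : 0 < (k + 2) ^+ 2 by rewrite exprn_gt0 // ltr_wpDl.
have test (x : R) : sqmod (c + 'i%C * K * x%:C%C) <= sqmod c * (1 + x ^+ 2).
  pose xC := x%:C%C; pose M := (k + 2) ^+ 2 * (sqmod c * (1 + x ^+ 2)).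
  have XY : sandwich k S (mat c (K * xC) (- (K * xC)) c) =
            mat (K * c) (K * (c * xC)) (- (K * (c * xC))) (K * c).
    rewrite /sandwich /S (triangular_inv b l0 m0) !(matop_comp hdim hef).
    rewrite (matopZ hdim hef) !(matopD hdim hef) b0.
    by congr matop; rewrite ?scalarE /c; field; rewrite ?l0 ?m0.
  have M0 : 0 <= M.
    by rewrite !mulr_ge0 ?sqmod_ge0 ?(ltW K2) // addr_ge0 ?sqr_ge0.
  (* On (1, i) the matrix X acts as multiplication by c + i K x. *)
  have := sandwich_test XY M0 _ 1 'i%C.
  have -> : c * 1 + K * xC * 'i%C = c + 'i%C * K * xC by ring.
  have -> : - (K * xC) * 1 + c * 'i%C = 'i%C * (c + 'i%C * K * xC).
    by rewrite mulrDr !mulrA -expr2 sqr_i; ring.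
  have i1 : sqmod ('i%C : R[i]) = 1 by rewrite /sqmod /= expr0n expr1n add0r.
  rewrite sqmodM i1 mul1r sqmod1 => H1.
  suff : (k + 2) ^+ 2 * (sqmod (c + 'i%C * K * xC) + sqmod (c + 'i%C * K * xC))
    <= M * (1 + 1).
    by rewrite /M => H2; rewrite -(ler_pM2l K2); lra.
  apply: H1 => v.
  rewrite (lincomb_coord hdim hef v) (matopE hef) !(sqr_hnorm_lincomb hef).
  move: (dot v e) (dot v f) => y z.
  have -> : K * c * y + K * (c * xC) * z = K * c * (y + xC * z) by ring.
  have -> : - (K * (c * xC)) * y + K * c * z = K * c * (z - xC * y) by ring.
  have rot : sqmod (y + xC * z) + sqmod (z - xC * y) =
             (1 + x ^+ 2) * (sqmod y + sqmod z).
    by rewrite /xC /sqmod; case: y z => [y1 y2] [z1 z2] /=; ring.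
  by rewrite !sqmodM sqmod_real -mulrDr rot /M !mulrA.
move: sandwich_ratio_large test; rewrite /K /t; case: c => c1 c2 /=.
rewrite /sqmod /= => cK test.
set D := c1 ^+ 2 + c2 ^+ 2 in cK test.
have D0 : 0 < D by apply: lt_le_trans cK.
have DE : D = c1 ^+ 2 + c2 ^+ 2 by [].
(* The left side of [test] has the linear term 2 (k + 2) c2 x while the right side has none. For
   this [x] that term equals 2 D x^2, and the test becomes D x^2 + (k + 2)^2 x^2 <= 0. *)
have [x Dx] : exists x, D * x = (k + 2) * c2.
  by exists ((k + 2) * c2 / D); rewrite mulrC divfK ?gt_eqF.
have testx := test x.
have Dxx : D * x ^+ 2 = (k + 2) * c2 * x by rewrite -Dx; ring.
have x0 : D * x ^+ 2 <= 0.
  have : D * x ^+ 2 + (k + 2) ^+ 2 * x ^+ 2 <= 0 by clearbody D; lra.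
  by apply: le_trans; rewrite lerDl mulr_ge0 ?sqr_ge0.
have {}x0 : x = 0.
  by apply/eqP; rewrite -sqrf_eq0 eq_le sqr_ge0 andbT -(pmulr_rle0 _ D0).
move/eqP: Dx; rewrite x0 mulr0 eq_sym mulf_eq0 gt_eqF ?ltr_wpDl //.
by move=> /eqP.
Qed.

End TriangularForm.

(** * Diagonal operators and the Schur multiplier bound *)

Section DiagonalForm.
Variables (R : realType) (H : vectType R[i]) (dot : {dot H for Num.conj}).
Variables (e f : H).
Hypothesis hdim : \dim {:H} = 2%N.
Hypothesis hef : orthonormal_pair dot e f.

Local Notation mat := (matop dot e f).

(** If l = 0 the kernel contains [e]; if m = 0 it contains the vector (-b, l), nonzero since [l]
    is. *)
Lemma triangular_invertible_neq0 l b m :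
  invertible (mat l b 0 m) -> l != 0 /\ m != 0.
Proof.
move=> Si; have lincomb0 x y :
    mat l b 0 m (lincomb e f x y) = 0 -> x = 0 /\ y = 0.
  move/(invertible_eq0 Si) => xy0.
  have := dot_lincombr hef x y; have := dot_lincombl hef x y.
  by rewrite xy0 !linear0l => <- <-.
have l0 : l != 0.
  apply/eqP => l0; have [|/eqP] := lincomb0 1 0; last by rewrite oner_eq0.
  by rewrite (matopE hef) l0 !(mul0r, mulr0, addr0) /lincomb !scale0r addr0.
split=> //; apply/eqP => m0; have [|_ /eqP] := lincomb0 (- b) l;
  last by rewrite (negPf l0).
rewrite (matopE hef) m0 !(mul0r, addr0) mulrN mulrC addNr.
by rewrite /lincomb !scale0r addr0.
Qed.

Lemma invertible_diag a d : a != 0 -> d != 0 -> invertible (mat a 0 0 d).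
Proof.
move=> a0 d0; exists (mat a^-1 0 0 d^-1).
rewrite !(matop_comp hdim hef) -(matop1 hdim hef).
by rewrite !(mulr0, mul0r, addr0, add0r) !mulVf ?mulfV.
Qed.

Lemma spectrum_diag a d z : spectrum (mat a 0 0 d) z -> z = a \/ z = d.
Proof.
move=> zS; have [->|za] := eqVneq z a; first by left.
right; apply/eqP/negPn/negP => zd; apply: zS.
have -> : mat a 0 0 d - z *: \1%VF = mat (a - z) 0 0 (d - z).
  rewrite -(matop1 hdim hef) -scaleNr (matopZ hdim hef) (matopD hdim hef).
  by rewrite !(mulr0, addr0, mulr1).
by apply: invertible_diag; rewrite subr_eq0 eq_sym.
Qed.

Lemma selfadjoint_diag a d :
  a^* = a -> d^* = d -> selfadjoint dot (mat a 0 0 d).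
Proof.
move=> ar dr u v; rewrite (lincomb_coord hdim hef u) (lincomb_coord hdim hef v).
move: (dot u e) (dot u f) (dot v e) (dot v f) => x y z t.
have dotE p q r s : dot (lincomb e f p q) (lincomb e f r s) = r^* * p + s^* * q.
  rewrite {2}/lincomb linearDr !linearZr_LR /=.
  by rewrite (dot_lincombl hef) (dot_lincombr hef).
by rewrite !(matopE hef) !dotE !(mul0r, addr0, add0r) !rmorphM /= ar dr; ring.
Qed.

(* The Schur multiplier with rows (1, s), (s, 1), where s = K / c, is the convex
   combination (1 + s) / 2 * Y + (1 - s) / 2 * U Y U with U = diag(1, -1). *)
Lemma ler_opnorm_schur (K c : R) x y z t : 0 < K -> K ^+ 2 <= c ^+ 2 ->
  K * opnorm dot (mat x y z t) <=
  opnorm dot (mat (K%:C%C * x) (c%:C%C * y) (c%:C%C * z) (K%:C%C * t)).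
Proof.
move=> K0 Kc; set X := mat x y z t; set Y := mat (_ * _) _ _ _.
have c0 : c != 0.
  by rewrite -sqrf_eq0 gt_eqF // (lt_le_trans _ Kc) // exprn_gt0.
(* This range makes both weights (1 + s) / 2 and (1 - s) / 2 nonnegative. *)
pose s := K / c; have /andP[s1 s2] : -1 <= s <= 1.
  rewrite -ler_norml -(@expr_le1 _ 2) // real_normK ?num_real // /s expr_div_n.
  by rewrite ler_pdivrMr ?mul1r ?exprn_even_gt0.
pose U := mat 1 0 0 (-1).
have hU v : hnorm dot (U v) = hnorm dot v.
  apply/eqP; rewrite -(@eqrXn2 _ 2) ?hnorm_ge0 // (lincomb_coord hdim hef v).
  by rewrite /U (matopE hef) !(sqr_hnorm_lincomb hef)
    !(mul0r, add0r, addr0, mul1r, mulN1r, sqmodN).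
(* Conjugation by [U] flips the sign of the off-diagonal entries, so the combination multiplies them
   by s, and s c = K. *)
have KX v : K%:C%C *: X v =
    ((1 + s) / 2)%:C%C *: Y v + ((1 - s) / 2)%:C%C *: U (Y (U v)).
  have sc : s * c = K by rewrite divfK.
  have scC : s%:C%C * c%:C%C = K%:C%C by rewrite -sc [RHS]rmorphM.
  have c0C : c%:C%C != 0 by rewrite (inj_eq (@complexI R)).
  rewrite (lincomb_coord hdim hef v) /X /Y /U !(matopE hef) !lincombZ lincombD.
  rewrite !rmorphM !rmorphD !rmorphN !fmorphV !rmorphMn /= -scC.
  by congr lincomb; field.
rewrite mulrC -ler_pdivlMr //; apply: opnorm_le => v v1.
rewrite ler_pdivlMr // mulrC -(hnormZ_ge0 dot _ (ltW K0)) KX.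
apply: le_trans (ler_hnormD _ _ _) _.
rewrite !hnormZ_ge0 ?divr_ge0 ?subr_ge0 ?hU //; last by rewrite -lerBlDl sub0r.
have -> : opnorm dot Y =
    (1 + s) / 2 * opnorm dot Y + (1 - s) / 2 * opnorm dot Y by field.
apply: lerD; apply: ler_wpM2l; rewrite ?divr_ge0 ?subr_ge0 //.
- by rewrite -lerBlDl sub0r.
- exact: (ler_opnorm1 hdim hef).
- by apply: (ler_opnorm1 hdim hef); rewrite hU.
Qed.

End DiagonalForm.

(** * Real numbers as fixed points of conjugation, and the equality of the two sets *)

Lemma conjc_eq_Im0 (R : realType) (z : R[i]) : z^* = z -> complex.Im z = 0.
Proof.
by case: z => x y [/eqP]; rewrite eq_sym -subr_eq0 opprK -mulr2n mulrn_eq0 =>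
  /eqP.
Qed.

Lemma Im0_conjc_eq (R : realType) (z : R[i]) : complex.Im z = 0 -> z^* = z.
Proof. by case: z => x y /= ->; exact: conjc_real. Qed.

Theorem mainTheorem3 (R : realType) (H : vectType R[i])
    (dot : {dot H for Num.conj}) (k : R)
    (hdim : \dim {:H} = 2%N) (hk : 0 <= k) :
  frakD dot k =
    [set alpha *: S | alpha in [set alpha : R[i] | alpha != 0]
                    & S in [set S : 'End(H) |
       invertible_selfadjoint dot S /\
       forall lambda mu : R[i], spectrum S lambda -> spectrum S mu ->
         (k + 2)%:C%C <= `|lambda / mu + mu / lambda + k%:C%C| ]].
Proof.
have k2 : 0 < k + 2 by rewrite ltr_wpDl.
apply/seteqP; split=> [S [Si hS]|_ [alpha /= a0 [S [[Si Sa] spS]] <-]];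
  last first.
  (* Right to left: a self-adjoint triangular [S] is diagonal with real entries, and the spectral
     condition at the pair [l], [m] bounds |c| from below. *)
  have [e [f [hef [l [b [m [SE Se]]]]]]] :=
    exists_orthonormal_pair_triangular dot hdim S.
  have [ee ff ef] := hef; have fe : dot f e = 0 by rewrite dot_conj ef conjC0.
  have [l0 m0] : l != 0 /\ m != 0.
    by rewrite SE in Si; exact: (triangular_invertible_neq0 hef Si).
  have Sf : S f = b *: e + m *: f.
    have := matopE hef l b 0 m 0 1.
    by rewrite -SE lincomb0r scale1r !(mulr0, mulr1, add0r).
  have b0 : b = 0.
    have := Sa f e; rewrite Se linearZr_LR /= fe mulr0 Sf linearDl.
    rewrite !linearZl_LR /=.
    by rewrite ee fe mulr1 mulr0 addr0.
  have lr : l^* = l.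
    by have := Sa e e; rewrite Se linearZl_LR linearZr_LR /= ee !mulr1.
  have mr : m^* = m.
    have := Sa f f; rewrite Sf b0 scale0r add0r linearZl_LR linearZr_LR /= ff.
    by rewrite !mulr1.
  have nz u : dot u u = 1 -> u != 0.
    by move=> u1; rewrite -(dnorm_eq0 dot) u1 oner_eq0.
  have := spS l m (spectrum_eigenvalue (nz e ee) Se).
  rewrite b0 scale0r add0r in Sf.
  move=> /(_ (spectrum_eigenvalue (nz f ff) Sf)).
  rewrite (le_norm_sqmod _ (ltW k2)).
  set c := l / m + m / l + k%:C%C => cK.
  have [cr cE] : exists cr : R, c = cr%:C%C.
    have : c^* = c.
      by rewrite /c !rmorphD !rmorphM /= !fmorphV /= lr mr; congr (_ + _);
        exact: conjc_real.
    by move/conjc_eq_Im0 => c0; exists (complex.Re c); rewrite [LHS]complexE c0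
      mulr0 addr0.
  rewrite cE sqmod_real in cK.
  have aS : alpha *: S = matop dot e f (alpha * l) 0 0 (alpha * m).
    by rewrite SE b0 (matopZ hdim hef) !mulr0.
  rewrite aS; split; first by apply: (invertible_diag hdim hef);
    rewrite mulf_neq0.
  move=> X; rewrite (matop_coord hdim hef X).
  move: (dot (X e) e) (dot (X f) e) (dot (X e) f) (dot (X f) f) => x y z t.
  apply: le_trans (ler_opnorm_schur hdim hef x y z t k2 cK) _.
  rewrite (triangular_inv hdim hef) ?mulf_neq0 //.
  rewrite !(matop_comp hdim hef) (matopZ hdim hef) !(matopD hdim hef).
  (* The factor [alpha] cancels in conjugation, so the image of X is exactly the matrix in the Schur
     bound. *)
  rewrite le_eqVlt; apply/orP; left; apply/eqP; congr opnorm.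
  by rewrite -cE /c (scalarE k); congr matop; field; rewrite ?a0 ?l0 ?m0.
(* Left to right: [S] turns out diagonal with m / l real, hence is [l] times the self-adjoint
   diag(1, m / l). *)
have [e [f [hef [l [b [m [SE _]]]]]]] :=
  exists_orthonormal_pair_triangular dot hdim S.
have [l0 m0] : l != 0 /\ m != 0.
  by rewrite SE in Si; exact: (triangular_invertible_neq0 hef Si).
rewrite SE in hS.
have b0 := sandwich_offdiag hdim hef hk l0 m0 hS.
have cK := sandwich_ratio_large hdim hef hk l0 m0 hS.
have cr := sandwich_ratio_real hdim hef hk l0 m0 hS.
have w0 : m / l != 0 by rewrite mulf_neq0 ?invr_eq0.
have wr : (m / l)^* = m / l.
  by apply/Im0_conjc_eq/(real_of_ratio_sum hk w0); rewrite invf_div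
    [m / l + _]addrC.
exists l => //; exists (matop dot e f 1 0 0 (m / l)); last first.
  by rewrite SE b0 (matopZ hdim hef) !mulr0 mulr1 mulrC divfK.
split.
  split; first by apply: (invertible_diag hdim hef); rewrite ?oner_eq0.
  by apply: (selfadjoint_diag hdim hef) => //; exact: rmorph1.
(* Case of equal spectral values, whose ratios are 1; distinct ones give [c] again. *)
have large1 : (k + 2) ^+ 2 <= sqmod (1 + 1 + k%:C%C).
  by rewrite -(@rmorph1 _ _ (real_complex R)) -!rmorphD sqmod_real
    [1 + 1 + k]addrC.
move=> z w /(spectrum_diag hdim hef) + /(spectrum_diag hdim hef).
rewrite (le_norm_sqmod _ (ltW k2)).
case=> -> [] ->; rewrite ?divff ?oner_eq0 // ?mul1r ?divr1 ?invf_div //.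
by rewrite [m / l + _]addrC.
Qed.
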